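(* Let $d,t\geq 2$ be integers and let $\mathcal{F}= \{(A^1_i, A^2_i,\ldots, A^d_i) : 1\leq i\leq t \}$ be a family of $t$ $d$-tuples of finite sets such that, for all $i,i'\in\{1,\dots,t\}$ and $j,j'\in\{1,\dots,d\}$, $A^j_i \cap A^{j'}_{i'}=\emptyset$ if and only if $i= i'$ and $j\neq j'$. Then $$\frac{d}{2}\, t\log_2 t \le \sum_{i=1}^{t}\sum_{j=1}^{d} |A^j_i|.$$
   Context: The superscript $j$ in $A_i^j$ is an index (position in the $d$-tuple), not a power. The property with $i=i'$, $j=j'$ says in particular that every $A_i^j$ is nonempty. *)

(* Defs.v *)
From mathcomp Require Import all_boot all_order all_algebra.
From mathcomp Require Import finmap.
From mathcomp Require Import reals exp.

Set Implicit Arguments.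
Unset Strict Implicit.
Unset Printing Implicit Defensive.

Import Order.TTheory GRing.Theory Num.Theory.
Local Open Scope ring_scope.

Definition log2 (R : realType) (x : R) : R := ln x / ln 2.

(* [A i j] is the j-th entry of the i-th tuple; indices start at 0. *)
Definition cross_intersecting_tuples (K : choiceType) (d t : nat)
    (A : 'I_t -> 'I_d -> {fset K}) : Prop :=
  forall (i i' : 'I_t) (j j' : 'I_d),
    (A i j `&` A i' j')%fset = fset0 <-> (i = i' /\ j <> j').

(* Main.v *)
Require Import Defs.
From mathcomp Require Import all_boot all_order all_algebra.
From mathcomp Require Import finmap.
From mathcomp Require Import reals exp.

(** A random set [X] that contains each [x] independently with probability
    [p x] contains [A] and avoids [B] with probability
    [\prod_(x in A) p x * \prod_(x in B) (1 - p x)].  For the pairs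
    [(A i, B i)] of a weakly cross-intersecting family these events exclude one
    another, so their probabilities sum to at most [1] (Tuza).  At [p = 1 / 2]
    this reads [\sum_i 2 ^- (#|A i| + #|B i|) <= 1], and the inequality between
    arithmetic and geometric means turns it into
    [t ^ t <= 2 ^ \sum_i (#|A i| + #|B i|)].  Applying this to the positions
    [j] and [j + 1] modulo [d] and multiplying over [j] counts every set
    twice. *)

Set Implicit Arguments.
Unset Strict Implicit.
Unset Printing Implicit Defensive.

Import Order.TTheory GRing.Theory Num.Theory.
Local Open Scope ring_scope.

Definition separators (T : finType) (A B : {set T}) : {set {set T}} :=
  [set X : {set T} | (A \subset X) && [disjoint X & B]].

Section SubsetWeight.
Variables (R : comNzRingType) (T : finType) (p : T -> R).
Implicit Types A B X : {set T}.

Definition subset_weight X : R := \prod_x (if x \in X then p x else 1 - p x).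

Lemma subset_weight_separators A B X :
  \prod_x (if x \in X then if x \in B then 0 else p x
           else if x \in A then 0 else 1 - p x) =
    if X \in separators A B then subset_weight X else 0.
Proof.
rewrite inE; case: ifPn => [/andP[/subsetP sAX dXB]|].
  apply: eq_bigr => x _; have [xX|xNX] := boolP (x \in X).
    by rewrite (disjointFr dXB xX).
  by rewrite (contraNF (sAX x) xNX).
rewrite negb_and => /orP[/subsetPn[x xA xNX]|/pred0Pn[x /andP[/= xX xB]]].
  by rewrite (bigD1 x) //= (negPf xNX) xA mul0r.
by rewrite (bigD1 x) //= xX xB mul0r.
Qed.

Lemma sum_subset_weight_separators A B :
  [disjoint A & B] ->
  \sum_(X in separators A B) subset_weight X =
    \prod_(x in A) p x * \prod_(x in B) (1 - p x).
Proof.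
move=> dAB; rewrite big_mkcond.
under eq_bigr => X _ do rewrite -subset_weight_separators.
rewrite -bigA_distr [in RHS]big_mkcond [X in _ * X]big_mkcond -big_split /=.
apply: eq_bigr => x _; case: (boolP (x \in A)) => [xA|_].
  by rewrite (disjointFr dAB xA) addr0 mulr1.
by rewrite mul1r; case: ifP => _; rewrite ?add0r // addrC subrK.
Qed.

Lemma sum_subset_weight : \sum_X subset_weight X = 1.
Proof.
have disjoint0set X : [disjoint set0 & X] by rewrite disjoints_subset sub0set.
rewrite (eq_bigl (mem (separators set0 set0))) => [|X].
  by rewrite sum_subset_weight_separators // !big_set0 mulr1.
by rewrite /= inE sub0set disjoint_sym disjoint0set.
Qed.

End SubsetWeight.

Lemma subset_weight_ge0 (R : numDomainType) (T : finType) (p : T -> R)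
    (X : {set T}) :
  (forall x, 0 <= p x <= 1) -> 0 <= subset_weight p X.
Proof.
move=> p01; apply: prodr_ge0 => x _; have /andP[p_ge0 p_le1] := p01 x.
by case: ifP; rewrite ?subr_ge0.
Qed.

Section WeaklyCrossIntersecting.
Variables (I T : finType) (A B : I -> {set T}).
Hypothesis disjointAB : forall i i',
  [disjoint A i & B i'] && [disjoint A i' & B i] = (i == i').

Let disjointAB_diag i : [disjoint A i & B i].
Proof. by have := disjointAB i i; rewrite eqxx andbb. Qed.

Lemma card_index_separators_le1 (X : {set T}) :
  (#|[pred i | X \in separators (A i) (B i)]| <= 1)%N.
Proof.
apply/card_le1_eqP => i i' /setIdP[AX XB] /setIdP[A'X XB'].
apply/eqP; rewrite eq_sym -disjointAB.
by rewrite (disjointWl A'X XB) (disjointWl AX XB').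
Qed.

Lemma tuza_inequality (R : numDomainType) (p : T -> R) :
  (forall x, 0 <= p x <= 1) ->
  \sum_i (\prod_(x in A i) p x * \prod_(x in B i) (1 - p x)) <= 1.
Proof.
move=> p01.
under eq_bigr => i _.
  rewrite -(sum_subset_weight_separators p (disjointAB_diag i)); over.
rewrite -(sum_subset_weight p) (exchange_big_dep predT) //=.
apply: ler_sum => X _; rewrite sumr_const -[leRHS]mulr1n.
by rewrite ler_wpMn2l ?subset_weight_ge0 ?card_index_separators_le1.
Qed.

Lemma sum_expr_half_card_le1 (R : numFieldType) :
  \sum_i 2^-1 ^+ (#|A i| + #|B i|) <= 1 :> R.
Proof.
have half01 (x : T) : 0 <= (2^-1 : R) <= 1.
  by rewrite invr_ge0 ler0n invf_le1 ?ltr0n // ler1n.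
rewrite (le_trans _ (tuza_inequality half01)) // ler_sum // => i _.
have -> : 1 - 2^-1 = 2^-1 :> R by rewrite [X in X - _](splitr 1) mul1r addrK.
by rewrite !prodr_const exprD.
Qed.

End WeaklyCrossIntersecting.

Lemma exp_card_mul_prod_le1 (R : numDomainType) (I : finType) (w : I -> R) :
  (forall i, 0 <= w i) -> \sum_i w i <= 1 ->
  #|I|%:R ^+ #|I| * \prod_i w i <= 1.
Proof.
move=> w_ge0 w_le1.
have le_agm : \prod_i (w i *+ #|I|) <= (\sum_i w i) ^+ #|I|.
  by apply: leif_AGM_scaled => i _; rewrite mulrn_wge0.
rewrite -natrX mulr_natl -prodrMn_const (le_trans le_agm) //.
by rewrite exprn_ile1 // sumr_ge0.
Qed.

Lemma exp_card_le_exp2_sum (R : numFieldType) (I : finType) (s : I -> nat) :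
  \sum_i 2^-1 ^+ s i <= 1 :> R -> (#|I| ^ #|I| <= 2 ^ \sum_i s i)%N.
Proof.
move=> kraft; have := @exp_card_mul_prod_le1 R I (fun i => 2^-1 ^+ s i).
rewrite -expr_sum exprVn ler_pdivrMr ?exprn_gt0 ?ltr0n // mul1r.
by rewrite -!natrX ler_nat; apply=> // i; rewrite exprn_ge0 ?invr_ge0 ?ler0n.
Qed.

Lemma weakly_cross_intersecting_exp_card_le (K : choiceType) (I : finType)
    (A B : I -> {fset K}) :
  (forall i i', [disjoint A i & B i']%fset && [disjoint A i' & B i]%fset
    = (i == i')) ->
  (#|I| ^ #|I| <= 2 ^ \sum_i (#|` A i| + #|` B i|))%N.
Proof.
move=> dAB; pose G := (\bigcup_(i <- enum I) (A i `|` B i))%fset.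
have sABG i : (A i `|` B i `<=` G)%fset.
  by apply: bigfcup_sup; rewrite ?mem_enum.
have sAG i := fsubset_trans (fsubsetUl _ _) (sABG i).
have sBG i := fsubset_trans (fsubsetUr _ _) (sABG i).
under eq_bigr => i _ do rewrite -(card_fsub (sAG i)) -(card_fsub (sBG i)).
apply: (@exp_card_le_exp2_sum rat); apply: sum_expr_half_card_le1 => i i'.
by rewrite !disjoint_fsub ?fsubUset ?sAG ?sBG.
Qed.

Lemma ordS_neq (n : nat) (i : 'I_n) : (1 < n)%N -> ordS i != i.
Proof.
move=> n_gt1; apply/eqP => /(congr1 val) /=.
have [lt_in|le_ni] := ltnP i.+1 n; first by rewrite modn_small // => /esym/n_Sn.
have nE : i.+1 = n by apply/eqP; rewrite eqn_leq ltn_ord.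
by rewrite nE modnn => i0; rewrite -nE -i0 in n_gt1.
Qed.

Lemma cross_intersecting_tuples_disjoint (K : choiceType) (d t : nat)
    (A : 'I_t -> 'I_d -> {fset K}) (i i' : 'I_t) (j j' : 'I_d) :
  cross_intersecting_tuples A ->
  [disjoint A i j & A i' j']%fset = (i == i') && (j != j').
Proof.
move=> hA; rewrite -fsetI_eq0; apply/eqP/andP.
  by move=> /hA[-> /eqP].
by move=> [/eqP ii' /eqP jj']; apply/hA.
Qed.

Lemma cross_intersecting_tuples_exp_le (K : choiceType) (d t : nat)
    (A : 'I_t -> 'I_d -> {fset K}) :
  (1 < d)%N -> cross_intersecting_tuples A ->
  (t ^ (t * d) <= 2 ^ (2 * \sum_(i < t) \sum_(j < d) #|` A i j|))%N.
Proof.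
move=> d_gt1 hA; pose c j := (\sum_(i < t) #|` A i j|)%N.
have pair_le j : (t ^ t <= 2 ^ (c j + c (ordS j)))%N.
  rewrite -big_split -[t in (t ^ t)%N]card_ord.
  apply: weakly_cross_intersecting_exp_card_le => i i'.
  rewrite !cross_intersecting_tuples_disjoint // [j == _]eq_sym ordS_neq //.
  by rewrite !andbT [i' == i]eq_sym andbb.
have -> : (2 * \sum_(i < t) \sum_(j < d) #|` A i j|
    = \sum_(j < d) (c j + c (ordS j)))%N.
  rewrite big_split exchange_big mul2n -addnn; congr (_ + _)%N.
  exact: (reindex_inj (@ordS_inj d)).
rewrite expnM -[d in X in (X <= _)%N]card_ord -prod_nat_const expn_sum.
exact: leq_prod.
Qed.

Lemma mulr_log2_le (R : realType) (m n k : nat) :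
  (0 < m)%N -> (m ^ n <= 2 ^ k)%N -> n%:R * log2 (m%:R : R) <= k%:R.
Proof.
move=> m_gt0 le_mn; rewrite /log2 mulrA ler_pdivrMr ?ln_gt0 ?ltr1n //.
rewrite !mulr_natl -!lnXn ?ltr0n //.
by rewrite ler_ln ?posrE ?exprn_gt0 ?ltr0n // -!natrX ler_nat.
Qed.

Theorem theorem7 (R : realType) (K : choiceType) (d t : nat)
    (hd : (2 <= d)%N) (ht : (2 <= t)%N)
    (A : 'I_t -> 'I_d -> {fset K})
    (hA : cross_intersecting_tuples A) :
  d%:R / 2 * (t%:R * log2 (t%:R : R))
    <= (\sum_(i < t) \sum_(j < d) #|` A i j|)%:R.
Proof.
rewrite -mulrA mulrCA ler_pdivrMl // mulrA -!natrM [(d * t)%N]mulnC.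
apply: mulr_log2_le; first exact: ltnW.
exact: cross_intersecting_tuples_exp_le.
Qed.
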